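(* For any centrally symmetric convex body $X\subset\mathbb R^{2n}$ one has $$c_{ZA}(X)\ge 3\,c_J(X).$$
   Context: A convex body is a compact convex set with nonempty interior; it is centrally symmetric if $X=-X$. Let $\omega$ be the standard symplectic form on $\mathbb R^{2n}$. The symplectic polar of a convex body $X$ with the origin in its interior is $X^\omega=\{y\in\mathbb R^{2n} : \omega(x,y)\le 1\ \forall x\in X\}$. For a centrally symmetric convex body $X\subset\mathbb R^{2n}$, the number $c_J(X)$ is defined by $c_J(X)^{-1}=\max\{|\omega(x,y)| : x,y\in X^\omega\}$. For a symplectic linear subspace $L\subset\mathbb R^{2n}$ (i.e. $\omega_L:=\omega|_L$ is nondegenerate), let $L^{\perp_\omega}=\{y:\omega(x,y)=0\ \forall x\in L\}$, so $\mathbb R^{2n}=L\oplus L^{\perp_\omega}$, and let $\pi_{L,\omega}$ be the projection onto $L$ along $L^{\perp_\omega}$. The cylindrical affine capacity of a convex body $X\subset\mathbb R^{2n}$ is $$c_{ZA}(X)=\inf_L \operatorname{vol}(\pi_{L,\omega}(X)),$$ the infimum over all two-dimensional symplectic linear subspaces $L\subset\mathbb R^{2n}$, where the area on $L$ is the one defined by $\omega_L$ (a parallelogram spanned by $u,v\in L$ has area $|\omega(u,v)|$). *)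

(* Defs.v *)
From HB Require Import structures.
From mathcomp Require Import all_boot all_order all_algebra.
From mathcomp Require Import ring.
From mathcomp Require Import all_classical all_reals all_analysis.

Set Implicit Arguments.
Unset Strict Implicit.
Unset Printing Implicit Defensive.

Import Order.TTheory GRing.Theory Num.Theory.
Import numFieldNormedType.Exports.

Local Open Scope classical_set_scope.
Local Open Scope ring_scope.

Section ConvexBody.
Context {R : realType} {m : nat}.

Definition convex_body (X : set 'rV[R]_m) : Prop :=
  [/\ compact X, convex_set X & X° !=set0].

Definition centrally_symmetric (X : set 'rV[R]_m) : Prop :=
  X = [set - x | x in X].

End ConvexBody.

Section StandardForm.
Context {R : realType} {n : nat}.
Implicit Types x y : 'rV[R]_(n + n).

(* The coordinates of R^(2n) are (q_1, .., q_n, p_1, .., p_n). *)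
Definition omega x y : R :=
  \sum_(i < n) (x 0 (lshift n i) * y 0 (rshift n i)
                - x 0 (rshift n i) * y 0 (lshift n i)).

Lemma omega_bilinear : bilinear_for *%R (idfun \; *%R) omega.
Proof.
split=> [y a x x'|x a y y'] /=; rewrite /omega mulr_sumr -big_split /=;
  by apply: eq_bigr => i _; rewrite !mxE; ring.
Qed.

Lemma omega_skew x y : omega x y = (-1) ^+ true * idfun (omega y x).
Proof.
rewrite expr1 mulN1r /omega -sumrN /=.
by apply: eq_bigr => i _; ring.
Qed.

HB.instance Definition _ := bilinear_isBilinear.Build R
  'rV[R]_(n + n) 'rV[R]_(n + n) R *%R (idfun \; *%R) omega omega_bilinear.

HB.instance Definition _ := isHermitianSesquilinear.Build R
  'rV[R]_(n + n) true idfun omega omega_skew.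

End StandardForm.

Section Capacities.
Context {R : realType} {n : nat}.
Local Notation V := 'rV[R]_(n + n).
Implicit Types (X A : set V) (L : {vspace V}).

Definition symplectic_polar X : set V :=
  [set y | forall x, X x -> omega x y <= 1].

(* For a convex body that is symmetric about the origin, the polar is compact,
   so the supremum below is a maximum. *)
Definition c_J X : R :=
  (sup [set r | exists x y, [/\ symplectic_polar X x, symplectic_polar X y
                              & r = `|omega x y|]])^-1.

Definition symplectic_subspace L : Prop :=
  forall x, x \in L -> (forall y, y \in L -> omega x y = 0) -> x = 0.

(* The projection onto L along the symplectic complement of L. *)
Definition symplectic_proj L : 'End(V) := daddv_pi L (orthov (omega : {skew_symmetric V}) L).

(* On a plane L, the translation-invariant area for which the parallelogram
   spanned by u, v in L has area |omega u v|: Lebesgue measure in the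
   coordinates (s, t) |-> s u + t v of a basis (u, v) of L, times |omega u v|.
   The result does not depend on the basis, here the one chosen by vbasis. *)
Definition symplectic_area L A : \bar R :=
  let u := (vbasis L)`_0 in
  let v := (vbasis L)`_1 in
  (`|omega u v|%:E *
   (@lebesgue_measure R \x @lebesgue_measure R)
     [set p : R * R | A (p.1 *: u + p.2 *: v)%R])%E.

Definition c_ZA X : \bar R :=
  ereal_inf [set symplectic_area L (symplectic_proj L @` X) | L in
    [set L : {vspace V} | \dim L = 2%N /\ symplectic_subspace L]].

End Capacities.

(* Main.v *)
(* Let L be a symplectic plane with basis (u0, v0), and let K be the projection of
   X to L. A functional bounded by the gauge N of K is omega (., y) for some y in
   L that lies in the symplectic polar of X, so any two such functionals have
   determinant at most s = |omega u0 v0| / c_J X, and the claim becomes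
   area K >= 3 / s for a planar symmetric convex body K.
   Inscribe in K an affine regular hexagon u, v, v - u, - u, - v, u - v. The
   functionals supporting K at u, v, v - u, rotated by a quarter turn and scaled
   by D = det (u, v), are (up to sign) points of three edges of the hexagon, one
   in each pair of opposite edges. Supporting N at these points shows that their
   norm is at most D s. Dividing by D s gives points of K (possibly inside the
   hexagon), and each of the six cones over the edges then contains two triangles
   of K of total area D / (2 D s) = 1 / (2 s). *)
Require Import Defs.
From mathcomp Require Import all_boot all_order all_algebra.
From mathcomp Require Import ring lra.
From mathcomp Require Import all_classical all_reals all_analysis.
From mathcomp Require Import measurable_realfun unstable.

Set Implicit Arguments.
Unset Strict Implicit.
Unset Printing Implicit Defensive.

Import Order.TTheory GRing.Theory Num.Theory.
Import numFieldNormedType.Exports.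

Local Open Scope classical_set_scope.
Local Open Scope ring_scope.

(** Bundles the scaled pushforward as a measure, so that the uniqueness theorems for Lebesgue and
    product measure apply to it. *)
Lemma scaled_pushforward d1 d2 (T1 : measurableType d1) (T2 : measurableType d2)
    (R : realType) (m : {measure set T1 -> \bar R}) (f : T1 -> T2)
    (mf : measurable_fun setT f) (k : {nonneg R}) :
  exists nu : {measure set T2 -> \bar R},
    forall B, nu B = (k%:num%:E * m (f @^-1` B))%E.
Proof.
have [nu nuE] : exists nu : {measure set T2 -> \bar R},
    forall B, nu B = m (f @^-1` B).
  by unshelve eexists (pushforward m f : {measure set T2 -> \bar R}).
by exists (mscale k nu) => B; congr (_ * _)%E; exact: nuE.
Qed.

(** * Lebesgue measure under linear maps of the plane, and areas of triangles *)

Section PlanarMeasure.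
Context {R : realType}.
Local Notation leb := (@lebesgue_measure R).
Local Notation area := ((leb \x leb)%E).

Lemma measurable_fun_affine (a b : R) :
  measurable_fun [set: R] (fun y => a * y + b).
Proof. exact: measurable_funD. Qed.

(** [|a|] times the pushforward of Lebesgue measure agrees with it on half-open intervals, which
    determine it. A negative [a] reverses the preimages. *)
Lemma lebesgue_measure_affine (a b : R) (A : set R) : a != 0 -> measurable A ->
  leb ((fun y => a * y + b) @^-1` A) = (`|a|^-1%:E * leb A)%E.
Proof.
move=> a0 mA.
pose f : measurableTypeR R -> measurableTypeR R := fun y => a * y + b.
have mf : measurable_fun setT f by exact: measurable_fun_affine.
have a'0 : 0 <= `|a| by [].
have [nu nuE] : exists nu : {measure set (measurableTypeR R) -> \bar R},
    forall B, nu B = (`|a|%:E * leb (f @^-1` B))%E.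
  exact: (scaled_pushforward leb mf (NngNum a'0)).
suff -> : leb A = nu A.
  by rewrite nuE muleA -EFinM mulVf ?mul1e ?normr_eq0.
apply: lebesgue_measure_unique => //= _ [[x y] _ <-] /=; rewrite nuE.
have [a_lt0|a_gt0|/eqP] := ltgtP a 0; last by rewrite (negPf a0).
  rewrite (_ : f @^-1` _ = `[(y - b) / a, (x - b) / a[%classic); last first.
    apply/seteqP; split=> z /=; rewrite !in_itv /= ler_ndivrMr // ltr_ndivlMr //;
      rewrite lerBrDr ltrBlDr ![z * a]mulrC andbC //.
  rewrite !lebesgue_measure_itv /= !lte_fin.
  rewrite ltr_ndivrMr // divfK // ltrD2r; case: ifP => _; last by rewrite mule0.
  by rewrite -!EFinB -EFinM ltr0_norm //; congr EFin; field.
rewrite (_ : f @^-1` _ = `](x - b) / a, (y - b) / a]%classic); last first.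
  apply/seteqP; split=> z /=; rewrite !in_itv /= ler_pdivlMr // ltr_pdivrMr //;
    rewrite lerBrDr ltrBlDr ![z * a]mulrC //.
rewrite !lebesgue_measure_itv /= !lte_fin.
rewrite ltr_pdivrMr // divfK // ltrD2r; case: ifP => _; last by rewrite mule0.
by rewrite -!EFinB -EFinM gtr0_norm //; congr EFin; field.
Qed.

(** [U] is a union of open rational rectangles. The countable union runs over all of them; one that
    is not contained in [U] contributes the empty set. *)
Lemma measurable_open2 (U : set (R * R)) : open U -> measurable U.
Proof.
move=> oU.
pose B (q : (rat * rat) * (rat * rat)) : set (R * R) :=
  `]ratr q.1.1, ratr q.1.2[%classic `*` `]ratr q.2.1, ratr q.2.2[%classic.
have -> : U = \bigcup_q (B q `&` [set p | B q `<=` U]).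
  apply/seteqP; split; last by move=> p [q _ /= [Bq qU]]; exact: qU.
  move=> [x y] Uxy.
  have /nbhs_ballP[e /= e0 eU] : nbhs (x, y) U by exact: open_nbhs_nbhs.
  have itv (z : R) : exists q : rat * rat, (z \in `](ratr q.1), (ratr q.2)[) /\
      (forall w, (w \in `](ratr q.1), (ratr q.2)[) -> `|z - w| < e).
    have /rat_in_itvoo[q1] : z - e < z by rewrite ltrBlDr ltrDl.
    have /rat_in_itvoo[q2] : z < z + e by rewrite ltrDl.
    rewrite !in_itv /= => /andP[h1 h2] /andP[h3 h4].
    exists (q1, q2); rewrite /= in_itv /= h4 h1; split=> // w.
    rewrite in_itv /= => /andP[h5 h6].
    by rewrite ltr_norml; apply/andP; split; lra.
  have [qx [xq qxe]] := itv x; have [qy [yq qye]] := itv y.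
  exists (qx, qy) => //; split; first by split.
  by move=> [x' y'] [/= /qxe x'e /qye y'e]; apply: eU; split.
apply: countable_bigcupT_measurable => // q.
have [BU|BU] := pselect (B q `<=` U).
  rewrite (_ : _ `&` _ = B q); first exact: measurableX.
  by apply/seteqP; split => [? []|].
by rewrite (_ : _ `&` _ = set0) //; apply/seteqP; split => [? []|].
Qed.

Definition linear2 (a b c d : R) (p : R * R) : R * R :=
  (a * p.1 + b * p.2, c * p.1 + d * p.2).

Lemma measurable_linear2 a b c d (A : set (R * R)) : measurable A ->
  measurable (linear2 a b c d @^-1` A).
Proof.
move=> mA; rewrite -[X in measurable X]setTI.
have m2 x y : measurable_fun [set: R * R] (fun p : R * R => x * p.1 + y * p.2).
  by apply: measurable_funD;
    apply: measurable_funM.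
exact: (measurable_fun_pair (m2 a b) (m2 c d)).
Qed.

(** By uniqueness of the product measure, the scaled pushforward need only be computed on
    rectangles. *)
Lemma area_linear2_unique a b c d k (A : set (R * R)) : 0 <= k -> measurable A ->
  (forall B C : set R, measurable B -> measurable C ->
    (k%:E * area (linear2 a b c d @^-1` (B `*` C)) = leb B * leb C)%E) ->
  (k%:E * area (linear2 a b c d @^-1` A) = area A)%E.
Proof.
move=> k0 mA H.
have mf : measurable_fun [set: R * R] (linear2 a b c d).
  by move=> _ B mB; rewrite setTI; exact: measurable_linear2.
(* [R] and [measurableTypeR R] carry different measure displays. *)
pose Rm := measurableTypeR R.
have [nu nuE] := @scaled_pushforward _ _ (Rm * Rm)%type (Rm * Rm)%type R area
  (linear2 a b c d) mf (NngNum k0).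
rewrite /= in nuE; rewrite -nuE; apply/esym.
apply: (product_measure_unique (m1 := leb) (m2 := leb)) => // B C mB mC.
by rewrite nuE; apply: H.
Qed.

(** The preimage of a rectangle [B * C] has as its section at [x] an affine preimage of [C] if
    [a * x] lies in [B], and the empty set otherwise; integrating over [x] yields the second
    factor. *)
Lemma area_lower (a c d : R) (A : set (R * R)) :
  a != 0 -> d != 0 -> measurable A ->
  (`|a * d|%:E * area (linear2 a 0 c d @^-1` A) = area A)%E.
Proof.
move=> a0 d0 mA; apply: area_linear2_unique => // B C mB mC.
transitivity (`|a * d|%:E * \int[leb]_x
    ((`|d|^-1%:E * leb C) * (\1_((fun x => a * x + 0) @^-1` B) x)%:E))%E.
  congr (_ * _)%E; apply: eq_integral => x _ /=.
  rewrite indicE; have [xB|xB] := boolP (x \in _).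
    rewrite mule1 -(lebesgue_measure_affine (c * x)) //; congr (leb _).
    rewrite inE /= addr0 in xB.
    apply/seteqP; split=> y; rewrite /xsection /= inE /linear2 /= mul0r addr0;
      rewrite addrC //.
    by case.
  rewrite mule0 (_ : xsection _ _ = set0) ?measure0 //.
  apply/seteqP; split=> y //; rewrite /xsection /= inE /linear2 /= mul0r.
  move=> -[xB' _]; rewrite addr0 in xB'.
  by move/negP: xB; apply; rewrite inE /= addr0.
have mB' : measurable ((fun x => a * x + 0) @^-1` B).
  by rewrite -[X in measurable X]setTI; exact: measurable_fun_affine.
rewrite ge0_integralZl //; last first.
  by rewrite mule_ge0.
  by apply/measurable_EFinP; apply: measurable_indic.
rewrite integral_indic // setIT.
transitivity (`|a * d|%:E * (`|d|^-1%:E * leb C * (`|a|^-1%:E * leb B)))%E.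
  by congr (_ * (_ * _))%E; exact: lebesgue_measure_affine.
have ad1 : `|a * d| * (`|d|^-1 * `|a|^-1) = 1.
  by rewrite normrM; field; rewrite !normr_eq0 a0 d0.
have ad2 : (`|a * d|%:E * (`|d|^-1%:E * `|a|^-1%:E) = 1)%E by rewrite -!EFinM ad1.
by rewrite muleACA [LHS]muleA ad2 mul1e muleC.
Qed.

Lemma area_swap (A : set (R * R)) : measurable A ->
  area (linear2 0 1 1 0 @^-1` A) = area A.
Proof.
move=> mA; rewrite -[LHS]mul1e; apply: area_linear2_unique => // B C mB mC.
rewrite mul1e (_ : _ @^-1` _ = C `*` B).
  by rewrite [LHS]product_measure1E // muleC.
by apply/seteqP; split=> -[x y];
  rewrite /linear2 /= !mul0r !mul1r add0r addr0 => -[].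
Qed.

(** The lower triangular case, conjugated by the swap of coordinates. *)
Lemma area_upper (a b : R) (A : set (R * R)) : a != 0 -> measurable A ->
  (`|a|%:E * area (linear2 a b 0 1 @^-1` A) = area A)%E.
Proof.
move=> a0 mA; have mA' := measurable_linear2 0 1 1 0 mA.
rewrite -[RHS]area_swap // -(area_lower b (oner_neq0 R) a0 mA') mul1r.
congr (_ * _)%E.
rewrite -[RHS]area_swap; last exact: measurable_linear2.
congr (area _); apply/seteqP; split=> -[x y];
  by rewrite /linear2 /= !(mul0r, mul1r, add0r, addr0) [b * y + _]addrC.
Qed.

(** If [a != 0], the matrix is a lower times an upper triangular one; if [a = 0], it is a lower
    triangular one after the swap. *)
Lemma area_linear2 a b c d (A : set (R * R)) :
  a * d - b * c != 0 -> measurable A ->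
  (`|a * d - b * c|%:E * area (linear2 a b c d @^-1` A) = area A)%E.
Proof.
move=> D0 mA; have [a0|a0] := eqVneq a 0.
  move: D0; rewrite a0 mul0r sub0r oppr_eq0 mulf_eq0 negb_or => /andP[b0 c0].
  rewrite normrN -(area_lower d b0 c0 mA).
  rewrite -[X in (_ * X)%E = _]area_swap; last exact: measurable_linear2.
  congr (_ * area _)%E; apply/seteqP; split=> -[x y];
    by rewrite /linear2 /= !(mul0r, mul1r, add0r, addr0) addrC.
have d0 : d - b * c / a != 0.
  by apply: contraNneq D0 => H; rewrite -(mulr0 a) -H; apply/eqP; field.
rewrite -(area_lower (c / a) (oner_neq0 R) d0 mA) mul1r.
rewrite -(area_upper b a0 (measurable_linear2 1 0 (c / a) (d - b * c / a) mA)).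
have -> : linear2 a b c d =
    linear2 1 0 (c / a) (d - b * c / a) \o linear2 a b 0 1.
  by apply/funext => -[x y]; rewrite /linear2 /=; congr (_, _); field.
by rewrite muleA -EFinM -normrM; congr (`|_|%:E * _)%E; field.
Qed.

Definition open_triangle (a b : R * R) : set (R * R) :=
  [set p | exists s t, [/\ 0 < s, 0 < t, s + t < 1 &
     p = (s * a.1 + t * b.1, s * a.2 + t * b.2)]].

Let std : set (R * R) := [set p | [/\ 0 < p.1, 0 < p.2 & p.1 + p.2 < 1]].

Let measurable_std : measurable std.
Proof.
have m2 x y : measurable_fun [set: R * R] (fun p : R * R => x * p.1 + y * p.2).
  by apply: measurable_funD; apply: measurable_funM.
rewrite (_ : std = (fun p => 1 * p.1 + 0 * p.2) @^-1` `]0, +oo[ `&`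
   ((fun p => 0 * p.1 + 1 * p.2) @^-1` `]0, +oo[ `&`
   (fun p => 1 * p.1 + 1 * p.2) @^-1` `]-oo, 1[)).
  by apply: measurableI; [|apply: measurableI];
    rewrite -[X in measurable X]setTI; apply: m2.
apply/seteqP; split=> -[x y];
  rewrite /std /= !in_itv /= !mul1r !mul0r addr0 add0r !andbT.
  by case.
by case=> ? [].
Qed.

Let area_std : area std = (2^-1)%:E.
Proof.
(* The section over [x] has length [1 - x]. The exponent 1 makes the lemmas on powers of [x.~]
   applicable, with primitive [x.~ ^+ 2 / - 2]. *)
transitivity (\int[leb]_(x in `]0%R, 1%R[) (x.~ ^+ 1)%:E)%E.
  rewrite [RHS]integral_mkcond; apply: eq_integral => x _ /=; rewrite patchE.
  rewrite expr1 /onem; case: ifPn => [|x01].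
    rewrite inE /= in_itv /= => /andP[x0 x1].
    rewrite (_ : xsection _ _ = `]0, 1 - x[%classic).
      by rewrite lebesgue_measure_itv /= lte_fin subr_gt0 x1 -EFinB subr0.
    apply/seteqP; split=> y; rewrite /xsection /= inE in_itv /=.
      by move=> [/= _ -> H]; rewrite ltrBrDl.
    by move=> /andP[y0 H]; split=> //=; rewrite -ltrBrDl.
  rewrite (_ : xsection _ _ = set0) ?measure0 //.
  apply/seteqP; split=> y //; rewrite /xsection /= inE => -[/= x0 y0 xy1].
  by move/negP: x01; apply; rewrite inE /= in_itv /= x0; lra.
have cf : continuous (fun x : R => x.~ ^+ 1).
  by move=> x; exact: continuous_onemXn.
have := @integral_itv_bndoo R 0 1 (fun x => (x.~ ^+ 1)%:E) true false => <-.
  2: by apply/measurable_EFinP; apply: measurable_funTS;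
    exact: continuous_measurable_fun.
rewrite (@continuous_FTC2 _ _ (fun x => x.~ ^+ 2 / - 2)) //.
- by rewrite -EFinB /onem; congr EFin; field.
- exact: continuous_subspaceT.
- exact: derivable_oo_LRcontinuous_onemXnMr.
- by move=> x x01; rewrite derive1Mr // derive_onemXn mulrAC divff ?mul1r.
Qed.

(** The map is the inverse of the matrix with columns [a] and [b], so it sends them to the unit
    vectors. *)
Lemma open_triangleE (a b : R * R) : a.1 * b.2 - b.1 * a.2 != 0 ->
  open_triangle a b =
  linear2 (b.2 / (a.1 * b.2 - b.1 * a.2)) (- b.1 / (a.1 * b.2 - b.1 * a.2))
    (- a.2 / (a.1 * b.2 - b.1 * a.2)) (a.1 / (a.1 * b.2 - b.1 * a.2)) @^-1` std.
Proof.
case: a b => a1 a2 [b1 b2] /= D0; apply/seteqP; split=> [p|[x y]] /=.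
  move=> [s [t [s0 t0 st1 ->]]]; rewrite (_ : linear2 _ _ _ _ _ = (s, t)) //.
  by rewrite /linear2 /=; congr (_, _); field.
case=> s0 t0 st1; do 2 eexists; split; [exact: s0|exact: t0|exact: st1|].
by rewrite /linear2 /=; congr (_, _); field.
Qed.

Lemma area_open_triangle (a b : R * R) : a.1 * b.2 - b.1 * a.2 != 0 ->
  area (open_triangle a b) = (`|a.1 * b.2 - b.1 * a.2| / 2)%:E.
Proof.
move=> D0; rewrite open_triangleE //; set D := _ - _ in D0 *.
have D'0 : b.2 / D * (a.1 / D) - (- b.1 / D) * (- a.2 / D) = D^-1.
  by rewrite /D; field.
have := @area_linear2 (b.2 / D) (- b.1 / D) (- a.2 / D) (a.1 / D) std.
rewrite D'0 invr_eq0 => /(_ D0 measurable_std).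
rewrite area_std normfV => H.
rewrite EFinM -H muleA -EFinM mulfV ?mul1e // normr_eq0 //.
Qed.

Lemma measurable_open_triangle (a b : R * R) : a.1 * b.2 - b.1 * a.2 != 0 ->
  measurable (open_triangle a b).
Proof. by move=> D0; rewrite open_triangleE //; exact: measurable_linear2. Qed.

End PlanarMeasure.

(** * Norms on the plane: supporting functionals and inscribed hexagons *)

Section PlanarNorm.
Context {R : realType}.
Implicit Types (N : R -> R -> R) (t x y : R).

Definition planar_norm N : Prop :=
  [/\ forall x y x' y', N (x + x') (y + y') <= N x y + N x' y',
      forall t x y, N (t * x) (t * y) = `|t| * N x y
    & forall x y, N x y = 0 -> x = 0 /\ y = 0].

(** The unit ball of the dual norm; for an even [N] the one-sided bound also controls absolute
    values. *)
Definition dual_ball N : set (R * R) :=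
  [set f | forall x y, f.1 * x + f.2 * y <= N x y].

Lemma planar_norm_ge0 N x y : planar_norm N -> 0 <= N x y.
Proof.
case=> NA NZ _.
have := NA x y (-1 * x) (-1 * y); rewrite NZ normrN1 !mulN1r !subrr.
by have := NZ 0 0 0; rewrite !mul0r normr0 mul0r => ->; lra.
Qed.

Lemma planar_normN N x y : planar_norm N -> N (- x) (- y) = N x y.
Proof. by case=> _ NZ _; rewrite -mulN1r -[- y]mulN1r NZ normrN1 mul1r. Qed.

Lemma planar_norm_gt0 N x y : planar_norm N -> (x != 0) || (y != 0) ->
  0 < N x y.
Proof.
move=> NN xy0; rewrite lt_neqAle planar_norm_ge0 // andbT eq_sym.
by apply/eqP; case: NN => _ _ N0 /N0[x0 y0]; rewrite x0 y0 eqxx in xy0.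
Qed.

Lemma planar_norm_dist N x y x' y' : planar_norm N ->
  `|N x y - N x' y'| <= N (x - x') (y - y').
Proof.
move=> NN; have [NA _ _] := NN.
have := NA (x - x') (y - y') x' y'; have := NA (x' - x) (y' - y) x y.
rewrite !subrK -(planar_normN (x' - x)) // !opprB ler_norml => H1 H2.
by apply/andP; split; lra.
Qed.

(* The one-dimensional step of the Hahn-Banach theorem, extending the functional
   [t (a, b) |-> t * N a b] to the complement spanned by [(- b, a)]. *)
Lemma dual_ball_support N a b : planar_norm N -> (a != 0) || (b != 0) ->
  exists2 f : R * R, dual_ball N f & f.1 * a + f.2 * b = N a b.
Proof.
move=> NN ab0; have [NA NZ _] := NN.
have q0 : 0 < a ^+ 2 + b ^+ 2.
  rewrite lt_neqAle addr_ge0 ?sqr_ge0 // andbT eq_sym paddr_eq0 ?sqr_ge0 //.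
  by rewrite !sqrf_eq0 negb_and.
have Nab := planar_norm_ge0 a b NN.
(* The value [c] at [(- b, a)] has to be chosen. [S] holds the lower bounds imposed by the vectors
   [t (a, b) - (- b, a)]; the vectors [t' (a, b) + (- b, a)] impose upper bounds, and [Sub] places
   these above [S]. *)
pose S := [set r | exists t, r = t * N a b - N (t * a + b) (t * b - a)].
have Sub t' : ubound S (N (t' * a - b) (t' * b + a) - t' * N a b).
  move=> _ [t ->].
  have := NA (t * a + b) (t * b - a) (t' * a - b) (t' * b + a).
  rewrite (_ : t * a + b + _ = (t + t') * a); last by ring.
  rewrite (_ : t * b - a + _ = (t + t') * b); last by ring.
  rewrite NZ; have := ler_wpM2r Nab (ler_norm (t + t')); lra.
have Shs : has_sup S by split; [exists (0 * N a b - N (0 * a + b) (0 * b - a)), 0|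
  exists (N (0 * a - b) (0 * b + a) - 0 * N a b); exact: Sub].
pose c := sup S.
have c_lb t : t * N a b - N (t * a + b) (t * b - a) <= c.
  by apply: (ub_le_sup Shs.2); exists t.
have c_ub t : c <= N (t * a - b) (t * b + a) - t * N a b.
  by apply: ge_sup Shs.1 _; exact: Sub.
set q := a ^+ 2 + b ^+ 2 in q0; have qn0 : q != 0 by rewrite gt_eqF.
(* The sign of [be] decides which of the two bounds on [c] applies, after rescaling by [|be|]. *)
have H al be : al * N a b + be * c <= N (al * a - be * b) (al * b + be * a).
  have [be0|be0|->] := ltgtP be 0.
  - have nbe : 0 < - be by rewrite oppr_gt0.
    have -> : al * a - be * b = - be * (al / - be * a + b).
      by field; rewrite lt_eqF.
    have -> : al * b + be * a = - be * (al / - be * b - a).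
      by field; rewrite lt_eqF.
    rewrite NZ gtr0_norm //.
    have := ler_wpM2l (ltW nbe) (c_lb (al / - be)).
    rewrite mulrBr mulrA [_ * (al / _)]mulrC divfK ?gt_eqF //; lra.
  - have -> : al * a - be * b = be * (al / be * a - b).
      by field; rewrite gt_eqF.
    have -> : al * b + be * a = be * (al / be * b + a).
      by field; rewrite gt_eqF.
    rewrite NZ gtr0_norm //.
    have := ler_wpM2l (ltW be0) (c_ub (al / be)).
    rewrite mulrBr mulrA [_ * (al / _)]mulrC divfK ?gt_eqF //; lra.
  - rewrite !mul0r subr0 !addr0 NZ; exact: ler_wpM2r (ler_norm _).
(* The functional with values [N a b] at [(a, b)] and [c] at [(- b, a)]; these vectors are
   orthogonal of squared length [q]. *)
exists ((N a b * a - c * b) / q, (N a b * b + c * a) / q) => /=; last first.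
  by rewrite /q; field.
move=> x y /=; have := H ((a * x + b * y) / q) ((a * y - b * x) / q).
by congr (_ <= N _ _); rewrite /q; field.
Qed.

Lemma lipschitz_continuousR (f : R -> R) (C : R) :
  (forall x y, `|f x - f y| <= C * `|x - y|) -> continuous f.
Proof.
move=> fC x; apply/cvgrPdist_lt => e e0.
have C0 : 0 < `|C| + 1 by rewrite ltr_wpDl.
near=> y; apply: (le_lt_trans (fC x y)).
have xy : `|x - y| < e / (`|C| + 1).
  by near: y; apply: cvgr_dist_lt => //; rewrite divr_gt0.
move: xy; rewrite ltr_pdivlMr // mulrC; apply: le_lt_trans.
apply: ler_wpM2r => //; have := ler_norm C; lra.
Unshelve. all: by end_near. Qed.

(* Move [v] along the unit circle from [u] until [N (v - u)] reaches 1. *)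
Lemma inscribed_hexagon N : planar_norm N ->
  exists u v : R * R, [/\ N u.1 u.2 = 1, N v.1 v.2 = 1,
    N (v.1 - u.1) (v.2 - u.2) = 1 & u.1 * v.2 - v.1 * u.2 != 0].
Proof.
move=> NN; have [NA NZ _] := NN.
have N10 : 0 < N 1 0 by apply: planar_norm_gt0 => //; rewrite oner_eq0.
have N01 : 0 < N 0 1 by apply: planar_norm_gt0 => //; rewrite oner_eq0 orbT.
pose k := (N 1 0)^-1.
have k0 : 0 < k by rewrite invr_gt0.
have Nu : N k 0 = 1.
  have := NZ k 1 0; rewrite mulr1 mulr0 => ->.
  by rewrite gtr0_norm // /k mulVf // gt_eqF.
(* The vectors [(- k, m)] and [(- k, - m)] add up to [(- 2 k, 0)], of norm 2, so one of them has
   norm at least 1. *)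
have [l [l0 Nl Nlu]] : exists l, [/\ l != 0, N 0 l = 1 & 1 <= N (- k) l].
  pose m := (N 0 1)^-1; have m0 : 0 < m by rewrite invr_gt0.
  have Nm : N 0 m = 1.
    have := NZ m 0 1; rewrite mulr1 mulr0 => ->.
    by rewrite gtr0_norm // /m mulVf // gt_eqF.
  have [H|H] := lerP 1 (N (- k) m); first by exists m; rewrite gt_eqF.
  exists (- m); rewrite oppr_eq0 gt_eqF //; split=> //.
    by rewrite -oppr0 planar_normN.
  have := NA (- k) m (- k) (- m).
  rewrite subrr -mulr2n -mulr_natl -[X in N _ X](mulr0 2%:R) NZ normr_nat.
  by rewrite -{1}oppr0 planar_normN // Nu; lra.
pose C := N (- k) l.
(* The point at [t] of the segment from [(k, 0)] to [(0, l)], divided by its norm [g t], is the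
   moving [v]. The equation [h t = 0] says [N (v - u) = 1], multiplied by [g t] to avoid the
   division. *)
pose g t := N ((1 - t) * k) (t * l).
pose h t := N ((1 - t) * k - g t * k) (t * l) - g t.
have g_lip t t' : `|g t - g t'| <= C * `|t - t'|.
  apply: (le_trans (planar_norm_dist _ _ _ _ NN)).
  rewrite [C * _]mulrC /C -NZ le_eqVlt; apply/orP; left.
  by apply/eqP; congr N; ring.
(* One [C] comes from the moving point, and one from each of the two occurrences of [g]. *)
have h_lip t t' : `|h t - h t'| <= 3 * C * `|t - t'|.
  have H1 := planar_norm_dist ((1 - t) * k - g t * k) (t * l)
    ((1 - t') * k - g t' * k) (t' * l) NN.
  have H2 := NA ((t - t') * (- k)) ((t - t') * l) ((g t' - g t) * k)
    ((g t' - g t) * 0).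
  move: H1 H2; rewrite !NZ Nu -/C mulr1 [`|g t' - _|]distrC.
  rewrite (_ : (t - t') * - k + (g t' - g t) * k =
    (1 - t) * k - g t * k - ((1 - t') * k - g t' * k)); last by ring.
  rewrite mulr0 addr0 [(t - t') * l]mulrBl => H1 H2.
  have -> : h t - h t' = N ((1 - t) * k - g t * k) (t * l) -
    N ((1 - t') * k - g t' * k) (t' * l) - (g t - g t') by rewrite /h; ring.
  by apply: (le_trans (ler_normB _ _)); have := g_lip t t'; lra.
have h0 : h 0 = -1.
  have := NZ 0 0 0; rewrite !mul0r normr0 mul0r => N00.
  by rewrite /h /g subr0 mul1r mul0r Nu mul1r subrr N00 sub0r.
have h1 : 0 <= h 1.
  by rewrite /h /g subrr mul0r mul1r Nl mul1r sub0r subr_ge0.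
have [t t01 ht] : exists2 t, t \in `[0, 1] & h t = 0.
  apply: IVT => //.
    apply: continuous_subspaceT; exact: lipschitz_continuousR h_lip.
  by rewrite h0 ge_min le_max h1 lerN10 orbT.
(* Since [t] is nonzero, the point has a nonzero second coordinate; hence [g t > 0], and [u], [v]
   are independent. *)
have t0 : t != 0 by apply: contraPneq ht => ->; rewrite h0; lra.
have gt0 : 0 < g t.
  by apply: planar_norm_gt0 => //; rewrite (mulf_neq0 t0 l0) orbT.
exists (k, 0), ((1 - t) * k / g t, t * l / g t) => /=; split=> //.
- rewrite ![_ / g t]mulrC NZ ger0_norm ?invr_ge0 ?(ltW gt0) //.
  by rewrite mulVf // gt_eqF.
- have -> : (1 - t) * k / g t - k = (g t)^-1 * ((1 - t) * k - g t * k).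
    by field; rewrite gt_eqF.
  rewrite subr0 [_ / g t]mulrC NZ ger0_norm ?invr_ge0 ?(ltW gt0) //.
  have -> : N ((1 - t) * k - g t * k) (t * l) = g t.
    by move: ht => /eqP; rewrite subr_eq0 => /eqP.
  by rewrite mulVf // gt_eqF.
- by rewrite mulr0 subr0 !mulf_neq0 ?invr_eq0 // gt_eqF.
Qed.
End PlanarNorm.

(** * Area bounds from the cones over the edges of the hexagon *)

Section HexagonArea.
Context {R : realType}.
Local Notation leb := (@lebesgue_measure R).
Local Notation area := ((leb \x leb)%E).
Implicit Types (N : R -> R -> R) (u v p : R * R) (K A B : set (R * R)).

Definition det2 (u v : R * R) : R := u.1 * v.2 - v.1 * u.2.

(** For [det2 u v > 0] these are the positive combinations of [u] and [v]. The determinant form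
    makes disjointness of cones a matter of linear arithmetic. *)
Definition open_cone (u v : R * R) : set (R * R) :=
  [set p | 0 < det2 u p /\ 0 < det2 p v].

Lemma measurable_open_cone u v : measurable (open_cone u v).
Proof.
have m2 x y : measurable_fun [set: R * R] (fun p : R * R => x * p.1 + y * p.2).
  by apply: measurable_funD; apply: measurable_funM.
rewrite (_ : open_cone u v =
    (fun p => - u.2 * p.1 + u.1 * p.2) @^-1` `]0, +oo[ `&`
    (fun p => v.2 * p.1 + - v.1 * p.2) @^-1` `]0, +oo[).
  by apply: measurableI; rewrite -[X in measurable X]setTI; apply: m2.
apply/seteqP; split=> p; rewrite /open_cone /det2 /= !in_itv /= !andbT;
  by case=> H1 H2; split; lra.
Qed.

(** A degenerate triangle needs no inclusion, as its bound is 0; this covers a cutting point at an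
    end of its edge. *)
Lemma area_ge_open_triangle u v A : measurable A ->
  (det2 u v != 0 -> open_triangle u v `<=` A) ->
  ((`|det2 u v| / 2)%:E <= area A)%E.
Proof.
move=> mA TA; have [->|D0] := eqVneq (det2 u v) 0.
  by rewrite normr0 mul0r; exact: measure_ge0.
rewrite -area_open_triangle //; apply: le_measure; rewrite ?inE //.
- exact: measurable_open_triangle.
- exact: TA.
Qed.

Lemma area_setU_ge K A B a b : measurable K -> measurable A -> measurable B ->
  A `&` B = set0 -> (a%:E <= area (K `&` A))%E -> (b%:E <= area (K `&` B))%E ->
  ((a + b)%:E <= area (K `&` (A `|` B)))%E.
Proof.
move=> mK mA mB AB0 aA bB; rewrite setIUr measureU.
- by rewrite EFinD; exact: leeD.
- exact: measurableI.
- exact: measurableI.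
- by rewrite setIACA AB0 setI0.
Qed.

(* A point of the segment [u, v], divided by its norm [s], cuts the cone into two
   triangles of total area [det2 u v / s / 2]. *)
Lemma area_open_cone_ge N K u v t s : planar_norm N -> measurable K ->
  (forall p, N p.1 p.2 < 1 -> K p) -> 0 < det2 u v -> 0 < s -> 0 <= t <= 1 ->
  N u.1 u.2 <= 1 -> N v.1 v.2 <= 1 ->
  N ((1 - t) * u.1 + t * v.1) ((1 - t) * u.2 + t * v.2) <= s ->
  ((det2 u v / s / 2)%:E <= area (K `&` open_cone u v))%E.
Proof.
move=> [NA NZ N0] mK NK D0 s0 /andP[t0 t1] Nu Nv Np.
pose w : R * R := (((1 - t) * u.1 + t * v.1) / s, ((1 - t) * u.2 + t * v.2) / s).
have Nw : N w.1 w.2 <= 1.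
  rewrite /w /= ![_ / s]mulrC NZ gtr0_norm ?invr_gt0 //.
  by rewrite mulrC ler_pdivrMr // mul1r.
have sn0 : s != 0 by rewrite gt_eqF.
have Duw : det2 u w = t * (det2 u v / s) by rewrite /det2 /w /=; field.
have Dwv : det2 w v = (1 - t) * (det2 u v / s) by rewrite /det2 /w /=; field.
have Ds : 0 < det2 u v / s by rewrite divr_gt0.
(* Points of an open triangle have norm strictly below 1, so the open unit ball inside [K]
   suffices. *)
have TK a b : N a.1 a.2 <= 1 -> N b.1 b.2 <= 1 -> open_triangle a b `<=` K.
  move=> Na Nb p [x [y [x0 y0 xy1 ->]]]; apply: NK => /=.
  apply: le_lt_trans xy1; apply: (le_trans (NA _ _ _ _)).
  rewrite !NZ !gtr0_norm //.
  by apply: lerD; rewrite -[leRHS]mulr1; apply: ler_wpM2l => //; exact: ltW.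
have -> : det2 u v / s / 2 = `|det2 u w| / 2 + `|det2 w v| / 2.
  rewrite Duw Dwv (normrM t) (normrM (1 - t)) [`|t|]ger0_norm //.
  rewrite [`|1 - t|]ger0_norm ?subr_ge0 //.
  by rewrite (gtr0_norm Ds); field.
(* The two sides of the ray through [w]. They are disjoint because [det2 p w] and [det2 w p] have
   opposite signs. *)
pose C1 := open_cone u v `&` open_cone u w.
pose C2 := open_cone u v `&` open_cone w v.
have mC1 : measurable C1 by apply: measurableI; exact: measurable_open_cone.
have mC2 : measurable C2 by apply: measurableI; exact: measurable_open_cone.
have := @area_setU_ge K C1 C2 (`|det2 u w| / 2) (`|det2 w v| / 2) mK mC1 mC2.
move=> H; apply: (le_trans (H _ _ _)); last first.
- apply: le_measure; rewrite ?inE.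
  + by apply: measurableI => //; apply: measurableU.
  + by apply: measurableI => //; exact: measurable_open_cone.
  + by move=> p [Kp [[]|[]]].
- apply: area_ge_open_triangle; first exact: measurableI.
  rewrite Dwv mulf_eq0 negb_or => /andP[t1' _] p Tp; split; first exact: TK Tp.
  have {t1'}t1 : 0 < 1 - t by rewrite lt_neqAle eq_sym t1' subr_ge0.
  have wv0 : 0 < det2 w v by rewrite Dwv mulr_gt0.
  move: Tp => [x [y [x0 y0 _ ->]]]; rewrite /C2 /open_cone /=.
  have -> : det2 w (x * w.1 + y * v.1, x * w.2 + y * v.2) = y * det2 w v.
    by rewrite /det2 /=; ring.
  have -> : det2 (x * w.1 + y * v.1, x * w.2 + y * v.2) v = x * det2 w v.
    by rewrite /det2 /=; ring.
  have -> : det2 u (x * w.1 + y * v.1, x * w.2 + y * v.2) =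
      x * det2 u w + y * det2 u v.
    by rewrite /det2 /=; ring.
  have uw0 : 0 <= det2 u w by rewrite Duw mulr_ge0 // ltW.
  split; split; rewrite ?mulr_gt0 //.
  by apply: ltr_wpDl; rewrite ?mulr_ge0 ?mulr_gt0 // ltW.
- apply: area_ge_open_triangle; first exact: measurableI.
  rewrite Duw mulf_eq0 negb_or => /andP[t0' _] p Tp; split; first exact: TK Tp.
  have {t0'}t0 : 0 < t by rewrite lt_neqAle eq_sym t0'.
  have uw0 : 0 < det2 u w by rewrite Duw mulr_gt0.
  move: Tp => [x [y [x0 y0 _ ->]]]; rewrite /C1 /open_cone /=.
  have -> : det2 u (x * u.1 + y * w.1, x * u.2 + y * w.2) = y * det2 u w.
    by rewrite /det2 /=; ring.
  have -> : det2 (x * u.1 + y * w.1, x * u.2 + y * w.2) w = x * det2 u w.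
    by rewrite /det2 /=; ring.
  have -> : det2 (x * u.1 + y * w.1, x * u.2 + y * w.2) v =
      x * det2 u v + y * det2 w v.
    by rewrite /det2 /=; ring.
  have wv0 : 0 <= det2 w v by rewrite Dwv mulr_ge0 ?subr_ge0 // ltW.
  split; split; rewrite ?mulr_gt0 //.
  by apply: ltr_pwDl; rewrite ?mulr_ge0 ?mulr_gt0 // ltW.
- apply/seteqP; split=> // p [[_ [_ H1]] [_ [H2 _]]].
  by move: H1 H2; rewrite /det2; lra.
Qed.

(* The three points lie on the edges [u, v], [v, v - u] and [v - u, - u] of the
   hexagon with vertices u, v, v - u, - u, - v, u - v. *)
Lemma area_hexagon_ge N K u v s a b c : planar_norm N -> measurable K ->
  (forall p, N p.1 p.2 < 1 -> K p) -> 0 < det2 u v -> 0 < s ->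
  0 <= a <= 1 -> 0 <= b <= 1 -> 0 <= c <= 1 ->
  N u.1 u.2 = 1 -> N v.1 v.2 = 1 -> N (v.1 - u.1) (v.2 - u.2) = 1 ->
  N ((1 - a) * u.1 + a * v.1) ((1 - a) * u.2 + a * v.2) <= s ->
  N (v.1 - b * u.1) (v.2 - b * u.2) <= s ->
  N (c * v.1 - u.1) (c * v.2 - u.2) <= s ->
  ((3 * (det2 u v / s))%:E <= area K)%E.
Proof.
move=> NN mK NK D0 s0 a01 b01 c01 Nu Nv Nw Na Nb Nc.
pose w : R * R := (v.1 - u.1, v.2 - u.2).
pose op (p : R * R) : R * R := (- p.1, - p.2).
have NNop p : N (op p).1 (op p).2 = N p.1 p.2 by exact: planar_normN.
(* On the edge from [w] to [op u] the point [c v - u] has parameter [1 - c]. *)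
have c'01 : 0 <= 1 - c <= 1 by move: c01 => /andP[]; lra.
have Dvw : det2 v w = det2 u v by rewrite /det2 /w /=; ring.
have Dwu : det2 w (op u) = det2 u v by rewrite /det2 /w /=; ring.
have Dop x y : det2 (op x) (op y) = det2 x y by rewrite /det2 /op /=; ring.
pose g := det2 u v / s / 2.
(* Each edge is treated together with its opposite, to which the evenness of [N] carries the
   bound. *)
have cone x y t : det2 x y = det2 u v -> 0 <= t <= 1 -> N x.1 x.2 = 1 ->
    N y.1 y.2 = 1 ->
    N ((1 - t) * x.1 + t * y.1) ((1 - t) * x.2 + t * y.2) <= s ->
    (g%:E <= area (K `&` open_cone x y))%E /\
    (g%:E <= area (K `&` open_cone (op x) (op y)))%E.
  move=> Dxy t01 Nx Ny Nt; rewrite /g; split.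
    rewrite -Dxy in D0 *.
    by apply: (area_open_cone_ge NN mK NK D0 s0 t01 _ _ Nt); rewrite ?Nx ?Ny.
  rewrite -Dxy -Dop in D0 *.
  apply: (area_open_cone_ge NN mK NK D0 s0 t01 _ _ _); rewrite ?NNop ?Nx ?Ny //.
  by rewrite /op /= !mulrN -!opprD planar_normN.
have [g1 g4] := cone u v a erefl a01 Nu Nv Na.
have [g2 g5] : (g%:E <= area (K `&` open_cone v w))%E /\
    (g%:E <= area (K `&` open_cone (op v) (op w)))%E.
  apply: (cone v w b) => //; apply: le_trans Nb.
  rewrite le_eqVlt; apply/orP; left.
  by apply/eqP; congr N; rewrite /w /=; ring.
have [g3 g6] : (g%:E <= area (K `&` open_cone w (op u)))%E /\
    (g%:E <= area (K `&` open_cone (op w) (op (op u))))%E.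
  apply: (cone w (op u) (1 - c)) => //; first by rewrite NNop.
  apply: le_trans Nc; rewrite le_eqVlt; apply/orP; left.
  by apply/eqP; congr N; rewrite /w /op /=; ring.
have mC := measurable_open_cone.
have -> : 3 * (det2 u v / s) = g + (g + (g + (g + (g + g)))).
  by rewrite /g; field; rewrite gt_eqF.
have mU5 := measurableU _ _ (mC (op v) (op w)) (mC (op w) (op (op u))).
have mU4 := measurableU _ _ (mC (op u) (op v)) mU5.
have mU3 := measurableU _ _ (mC w (op u)) mU4.
have mU2 := measurableU _ _ (mC v w) mU3.
have mU1 := measurableU _ _ (mC u v) mU2.
have {}H := area_setU_ge mK (mC (op v) (op w)) (mC (op w) (op (op u))) _ g5 g6.
have {}H := area_setU_ge mK (mC (op u) (op v)) mU5 _ g4 (H _).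
have {}H := area_setU_ge mK (mC w (op u)) mU4 _ g3 (H _ _).
have {}H := area_setU_ge mK (mC v w) mU3 _ g2 (H _ _ _).
have {}H := area_setU_ge mK (mC u v) mU2 _ g1 (H _ _ _ _).
have le : (area (K `&` (open_cone u v `|` (open_cone v w `|`
    (open_cone w (op u) `|` (open_cone (op u) (op v) `|`
    (open_cone (op v) (op w) `|` open_cone (op w) (op (op u)))))))) <= area K)%E.
  by apply: le_measure; rewrite ?inE; [exact: measurableI| |move=> p []].
(* Every determinant is expressed through [det2 u p] and [det2 p v], so that the pending
   disjointness goals become linear in two reals. *)
have detvp p : det2 v p = - det2 p v by rewrite /det2; ring.
have detpu p : det2 p u = - det2 u p by rewrite /det2; ring.
have detpw p : det2 p w = det2 u p + det2 p v by rewrite /det2 /w /=; ring.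
have detwp p : det2 w p = - (det2 u p + det2 p v) by rewrite /det2 /w /=; ring.
have detopl x p : det2 (op x) p = - det2 x p by rewrite /det2 /op /=; ring.
have detopr x p : det2 p (op x) = - det2 p x by rewrite /det2 /op /=; ring.
apply: le_trans le; apply: H; apply/seteqP; split=> // p; rewrite /open_cone /=;
  rewrite !(detvp, detpw, detwp, detopl, detopr, detpu);
  move: (det2 u p) (det2 p v); clear; intuition lra.
Qed.

(** The planar estimate. Its hypothesis on the dual ball bounds the norm of every rotated dual
    functional, which is how [s] enters the hexagon bound. *)
Lemma area_planar_norm_ge N K s : planar_norm N -> measurable K ->
  (forall p, N p.1 p.2 < 1 -> K p) ->
  (forall f g, dual_ball N f -> dual_ball N g -> `|det2 f g| <= s) ->
  ((3 / s)%:E <= area K)%E.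
Proof.
move=> NN mK NK Hs.
(* Exchanging [u] and [v] makes the determinant positive and only changes the sign of [v - u]. *)
have [u [v [Nu Nv Nw D0]]] : exists u v, [/\ N u.1 u.2 = 1, N v.1 v.2 = 1,
    N (v.1 - u.1) (v.2 - u.2) = 1 & 0 < det2 u v].
  have [u [v [Nu Nv Nw]]] := inscribed_hexagon NN.
  rewrite neq_lt => /orP[D0|D0]; last by exists u, v.
  exists v, u; split=> //; first by rewrite -planar_normN // !opprB.
  by rewrite /det2; lra.
have nz x y : N x y = 1 -> (x != 0) || (y != 0).
  move=> Nxy; apply: contraPT (Nxy).
  rewrite negb_or !negbK => /andP[/eqP-> /eqP->].
  by have [_ NZ _] := NN; have := NZ 0 0 0; rewrite !mul0r normr0 mul0r; lra.
have [f fN fu] := dual_ball_support NN (nz _ _ Nu).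
have [g gN gv] := dual_ball_support NN (nz _ _ Nv).
have [h hN hw] := dual_ball_support NN (nz _ _ Nw).
have dualN e x y : dual_ball N e -> N x y = 1 -> `|e.1 * x + e.2 * y| <= 1.
  move=> eN Nxy; rewrite ler_norml; apply/andP; split; last by rewrite -Nxy.
  by have := eN (- x) (- y); rewrite planar_normN // Nxy; lra.
(* [s] bounds the norm of a rotated functional, by supporting [N] there. *)
have rot e : dual_ball N e -> N (- e.2) e.1 <= s.
  move=> eN; have [e0|] := boolP ((- e.2 != 0) || (e.1 != 0)).
    have [k kN <-] := dual_ball_support NN e0.
    by apply: le_trans (Hs e k eN kN); apply: le_trans (ler_norm _);
      rewrite /det2; lra.
  rewrite negb_or !negbK => /andP[/eqP-> /eqP->].
  have [_ NZ _] := NN; have := NZ 0 0 0; rewrite !mul0r normr0 mul0r => ->.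
  by apply: le_trans (Hs f f fN fN).
(* [f] takes the value 1 at [u], so it is nonzero and its rotation has positive norm. *)
have s0 : 0 < s.
  apply: lt_le_trans (rot f fN); apply: planar_norm_gt0 => //.
  rewrite oppr_eq0 orbC -negb_and; apply: contraPN fu => /andP[/eqP-> /eqP->].
  by rewrite Nu !mul0r; lra.
have NZ' e : dual_ball N e ->
    N (det2 u v * - e.2) (det2 u v * e.1) <= det2 u v * s.
  by move=> eN; have [_ -> _] := NN; rewrite gtr0_norm // ler_wpM2l ?rot // ltW.
have := dualN f _ _ fN Nv; have := dualN f _ _ fN Nw.
have := dualN g _ _ gN Nu; have := dualN g _ _ gN Nw.
have := dualN h _ _ hN Nu; have := dualN h _ _ hN Nv.
rewrite Nu in fu; rewrite Nv in gv; rewrite Nw in hw.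
rewrite !ler_norml => /andP[H1 H2] /andP[H3 H4] /andP[H5 H6].
move=> /andP[H7 H8] /andP[H9 H10] /andP[H11 H12].
have -> : 3 / s = 3 * (det2 u v / (det2 u v * s)) by field; rewrite !gt_eqF.
(* The parameters lie in [[0, 1]]: each functional is 1 at its own vertex and at most 1 in absolute
   value at the others. For instance, [f (v) = 1 + f (v - u) >= 0]. *)
apply: (@area_hexagon_ge N K u v (det2 u v * s) (- (h.1 * u.1 + h.2 * u.2))
  (f.1 * v.1 + f.2 * v.2) (g.1 * u.1 + g.2 * u.2)) => //.
- exact: mulr_gt0.
- by apply/andP; split; lra.
- by apply/andP; split; lra.
- by apply/andP; split; lra.
(* All three points come from the identity [e (u) v - e (v) u = det2 u v (- e.2, e.1)], here with
   the opposite sign; below, 1 is replaced by [f (u)] or [g (v)] so that it applies. *)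
- have hE : 1 - - (h.1 * u.1 + h.2 * u.2) = h.1 * v.1 + h.2 * v.2 by lra.
  apply: le_trans (NZ' h hN); rewrite -planar_normN // le_eqVlt; apply/orP; left.
  by apply/eqP; rewrite hE; congr N; rewrite /det2; ring.
- have fE x : x = (f.1 * u.1 + f.2 * u.2) * x by rewrite fu mul1r.
  apply: le_trans (NZ' f fN); rewrite le_eqVlt; apply/orP; left; apply/eqP.
  by congr N; rewrite [X in X - _]fE /det2; ring.
- have gE x : x = (g.1 * v.1 + g.2 * v.2) * x by rewrite gv mul1r.
  apply: le_trans (NZ' g gN); rewrite le_eqVlt; apply/orP; left; apply/eqP.
  by congr N; rewrite [X in _ - X]gE /det2; ring.
Qed.

End HexagonArea.

(** * The Minkowski gauge of a symmetric convex absorbing set in the plane *)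

Section Gauge.
Context {R : realType}.
Variable K : set (R * R).
Hypothesis K_conv : forall x y x' y' t, 0 <= t <= 1 -> K (x, y) -> K (x', y') ->
  K (t * x + (1 - t) * x', t * y + (1 - t) * y').
Hypothesis K_sym : forall x y, K (x, y) -> K (- x, - y).
Hypothesis K_abs : forall x y, exists2 r, 0 < r & K (r * x, r * y).

Definition gauge x y : R := inf [set r | 0 < r /\ K (r^-1 * x, r^-1 * y)].

Let gauge_has_inf x y : has_inf [set r | 0 < r /\ K (r^-1 * x, r^-1 * y)].
Proof.
split; last by exists 0 => r [/ltW].
have [r r0 Kr] := K_abs x y; exists r^-1.
by rewrite /= invr_gt0 invrK.
Qed.

Lemma gauge_ge0 x y : 0 <= gauge x y.
Proof. by apply: lb_le_inf (gauge_has_inf x y).1 _ => r [/ltW]. Qed.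

Lemma gauge_le x y r : 0 < r -> K (r^-1 * x, r^-1 * y) -> gauge x y <= r.
Proof. by move=> r0 Kr; apply: ge_inf; [exact: (gauge_has_inf x y).2|]. Qed.

(** Some [r' < r] is admissible, and the point scaled by [r^-1] lies between the one scaled by
    [r'^-1] and the origin, which is in [K] as the midpoint of a symmetric pair. *)
Lemma gauge_lt x y r : gauge x y < r -> K (r^-1 * x, r^-1 * y).
Proof.
move=> /(inf_lt (gauge_has_inf x y).1)[r' [r'0 Kr'] r'r].
have r0 : 0 < r := lt_trans r'0 r'r.
have K0 : K (0, 0).
  have := K_conv (t := 2^-1) _ Kr' (K_sym Kr').
  rewrite (_ : _ * (r'^-1 * x) + _ = 0); last by field; rewrite gt_eqF.
  rewrite (_ : _ * (r'^-1 * y) + _ = 0); last by field; rewrite gt_eqF.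
  by apply; apply/andP; split; lra.
have t01 : 0 <= r' / r <= 1.
  by rewrite divr_ge0 ?(ltW r0) ?(ltW r'0) //= ler_pdivrMr // mul1r ltW.
have := K_conv t01 Kr' K0; rewrite !mulr0 !addr0 !mulrA.
by rewrite (_ : r' / r / r' = r^-1) //; field; rewrite !gt_eqF.
Qed.

(** The triangle inequality is convexity up to an arbitrary [e > 0]; definiteness is the assumption
    that [K] contains no ray from the origin. *)
Lemma gauge_planar_norm :
  (forall x y, (forall r, 0 < r -> K (r * x, r * y)) -> x = 0 /\ y = 0) ->
  planar_norm gauge.
Proof.
move=> K_def.
have gaugeZ_le t x y : t != 0 -> gauge (t * x) (t * y) <= `|t| * gauge x y.
  move=> t0; have nt0 : 0 < `|t| by rewrite normr_gt0.
  rewrite [`|t| * _]mulrC -ler_pdivrMr //; apply/ler_addgt0Pr => e e0.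
  rewrite ler_pdivrMr //.
  have /gauge_lt Kg : gauge x y < gauge x y + e by rewrite ltrDl.
  have ge_gt0 : 0 < gauge x y + e by rewrite ltr_wpDl // gauge_ge0.
  apply: gauge_le; first exact: mulr_gt0.
  have [tn|tp|/eqP] := ltgtP t 0; last by rewrite (negPf t0).
    move/K_sym : Kg; congr K; rewrite ltr0_norm //; congr (_, _);
      by field; rewrite t0 gt_eqF.
  move: Kg; congr K; rewrite gtr0_norm //; congr (_, _);
    by field; rewrite t0 gt_eqF.
split.
- move=> x y x' y'; apply/ler_addgt0Pr => e e0.
  have e20 : 0 < e / 2 by rewrite divr_gt0.
  have /gauge_lt K1 : gauge x y < gauge x y + e / 2 by rewrite ltrDl.
  have /gauge_lt K2 : gauge x' y' < gauge x' y' + e / 2 by rewrite ltrDl.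
  have a0 : 0 < gauge x y + e / 2 by rewrite ltr_wpDl // gauge_ge0.
  have b0 : 0 < gauge x' y' + e / 2 by rewrite ltr_wpDl // gauge_ge0.
  rewrite (_ : gauge x y + gauge x' y' + e =
    (gauge x y + e / 2) + (gauge x' y' + e / 2)); last by field.
  set a := gauge x y + e / 2 in K1 a0 *; set b := gauge x' y' + e / 2 in K2 b0 *.
  have ab0 : 0 < a + b by exact: addr_gt0.
  apply: gauge_le => //.
  (* The sum divided by [a + b] is the combination, with weights [a / (a + b)] and [b / (a + b)], of
     the two points scaled into [K]. *)
  have t01 : 0 <= a / (a + b) <= 1.
    by rewrite divr_ge0 ?(ltW a0) ?(ltW ab0) //= ler_pdivrMr // mul1r lerDl ltW.
  move: (K_conv t01 K1 K2); clearbody a b; congr K; congr (_, _);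
    by field; rewrite !gt_eqF.
- move=> t x y; have [->|t0] := eqVneq t 0.
    rewrite !mul0r normr0 mul0r; apply/eqP; rewrite eq_le gauge_ge0 andbT.
    apply/ler_addgt0Pr => e e0; rewrite add0r; apply: gauge_le => //.
    by rewrite !mulr0; have [r r0] := K_abs 0 0; rewrite !mulr0.
  (* The reverse inequality is the same one for the factor [t^-1]. *)
  apply/eqP; rewrite eq_le gaugeZ_le //=.
  have := gaugeZ_le t^-1 (t * x) (t * y); rewrite invr_eq0 => /(_ t0).
  by rewrite !mulKf // normfV mulrC ler_pdivlMr ?normr_gt0 // mulrC.
- move=> x y g0; apply: K_def => r r0.
  by have := @gauge_lt x y r^-1; rewrite invrK; apply; rewrite g0 invr_gt0.
Qed.

Lemma gauge_lt1 x y : gauge x y < 1 -> K (x, y).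
Proof. by move=> /gauge_lt; rewrite invr1 !mul1r. Qed.

Lemma gauge_le1 x y : K (x, y) -> gauge x y <= 1.
Proof. by move=> Kxy; apply: gauge_le => //; rewrite invr1 !mul1r. Qed.

End Gauge.

(** * The symplectic form in coordinates, and boundedness of the polar *)

Section Omega.
Context {R : realType} {n : nat}.
Local Notation V := 'rV[R]_(n + n).
Implicit Types (x y z u v : V) (a b : R).

Lemma omega_lin2 a b x y z :
  omega (a *: x + b *: y) z = a * omega x z + b * omega y z.
Proof.
rewrite /omega !mulr_sumr -big_split /=.
by apply: eq_bigr => i _; rewrite !mxE; ring.
Qed.

Lemma omegaC x y : omega x y = - omega y x.
Proof. by rewrite omega_skew expr1 mulN1r. Qed.

Lemma omega_xx x : omega x x = 0.
Proof. by rewrite /omega big1 // => i _; ring. Qed.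

Lemma omega_lin2r a b x y z :
  omega z (a *: x + b *: y) = a * omega z x + b * omega z y.
Proof. by rewrite omegaC omega_lin2 !(omegaC z) opprD !mulrN. Qed.

Lemma continuous_omegal y : continuous (omega^~ y).
Proof.
apply: continuous_big => [|i _]; first exact: add_continuous.
move=> x.
have c j (a : R) : {for x, continuous (fun M : V => M 0 j * a)}.
  apply: (@continuous_comp _ _ _ (fun M : V => M 0 j) ( *%R^~ a)).
    exact: coord_continuous.
  exact: mulrr_continuous.
exact: (continuousB (c _ _) (c _ _)).
Qed.

Lemma omega_deltal i a y :
  omega (a *: delta_mx 0 (lshift n i)) y = a * y 0 (rshift n i).
Proof.
rewrite /omega (bigD1 i) //= big1 => [|j ji]; rewrite !mxE !eqxx /=.
  by rewrite eq_rlshift /=; ring.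
by rewrite eq_rlshift eq_lshift (negPf ji) /=; ring.
Qed.

Lemma omega_deltar i a y :
  omega (a *: delta_mx 0 (rshift n i)) y = - a * y 0 (lshift n i).
Proof.
rewrite /omega (bigD1 i) //= big1 => [|j ji]; rewrite !mxE !eqxx /=.
  by rewrite eq_lrshift /=; ring.
by rewrite eq_lrshift eq_rshift (negPf ji) /=; ring.
Qed.

Lemma convex_setP (X : set V) x y a : convex_set X -> 0 <= a <= 1 ->
  X x -> X y -> X (a *: x + (1 - a) *: y).
Proof.
move=> Xc /andP[a0 a1] Xx Xy.
by have := Xc x y (Itv01 a0 a1); rewrite !inE; apply.
Qed.

Lemma centrally_symmetricN (X : set V) x :
  centrally_symmetric X -> X x -> X (- x).
Proof. by move=> XN Xx; rewrite XN; exists x. Qed.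

(** With [x0] interior, [x] is the midpoint of [x0 + 2 x] and [- x0]; this moves a ball about [x0]
    to the origin. *)
Lemma symmetric_body_ball (X : set V) : convex_body X -> centrally_symmetric X ->
  exists2 r, 0 < r & forall x, (forall i, `|x 0 i| < r) -> X x.
Proof.
move=> [_ Xc [x0 /nbhs_ballP[e /= e0 eX]]] XN.
exists (e / 2) => [|x xe]; first by rewrite divr_gt0.
have Xx0 : X x0 by apply: eX; exact: ballxx.
have X2 : X (x0 + 2 *: x).
  apply: eX; split=> // i j; rewrite /ball /= !mxE opprD addNKr normrN normrM.
  by rewrite normr_nat (ord1 i) mulrC -ltr_pdivlMr.
have h01 : (0 <= 2^-1 :> R) && (2^-1 <= 1 :> R) by apply/andP; split; lra.
have := convex_setP Xc h01 X2 (centrally_symmetricN XN Xx0).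
by congr X; apply/rowP => i; rewrite !mxE; field.
Qed.

(** Guarantees that the supremum in [c_J] is an upper bound. Testing against small multiples of the
    basis vectors, of both signs, confines the polar to a cube. *)
Lemma polar_omega_bounded (X : set V) : convex_body X -> centrally_symmetric X ->
  has_ubound [set r | exists x y, [/\ symplectic_polar X x, symplectic_polar X y
                              & r = `|omega x y|]].
Proof.
move=> hX XN; have [r r0 rX] := symmetric_body_ball hX XN.
have r20 : 0 < r / 2 by rewrite divr_gt0.
have Xd a j : `|a| < r -> X (a *: delta_mx 0 j).
  move=> ar; apply: rX => i; rewrite !mxE eqxx /=.
  by case: (i == j); rewrite ?mulr1 // mulr0 normr0.
have nr : `|r / 2| < r by rewrite gtr0_norm //; lra.
pose C := (r / 2)^-1.
have yC y : symplectic_polar X y -> forall j, `|y 0 j| <= C.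
  move=> Xy j; rewrite /C -[leRHS]mul1r ler_pdivlMr // mulrC.
  rewrite -(gtr0_norm r20) -normrM.
  have nr' : `|- (r / 2)| < r by rewrite normrN.
  rewrite ler_norml; case: (splitP j) => k jk.
    have -> : j = lshift n k by exact: val_inj.
    have := Xy _ (Xd _ (rshift n k) nr); have := Xy _ (Xd _ (rshift n k) nr').
    by rewrite !omega_deltar => H1 H2; apply/andP; split; lra.
  have -> : j = rshift n k by exact: val_inj.
  have := Xy _ (Xd _ (lshift n k) nr); have := Xy _ (Xd _ (lshift n k) nr').
  by rewrite !omega_deltal => H1 H2; apply/andP; split; lra.
exists (\sum_(i < n) (C * C + C * C)) => _ [x [y [Xx Xy ->]]].
apply: le_trans (ler_norm_sum _ _ _) _; apply: ler_sum => i _.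
apply: le_trans (ler_normB _ _) _; rewrite !normrM.
by apply: lerD; apply: ler_pM => //; exact: yC.
Qed.

End Omega.

(** * Symplectic planes and the projection onto them in a basis *)

Section SymplecticPlane.
Context {R : realType} {n : nat}.
Local Notation V := 'rV[R]_(n + n).
Local Notation leb := (@lebesgue_measure R).
Implicit Types (x y u v : V) (L : {vspace V}) (X : set V).

Lemma vspace2_vbasis L : \dim L = 2%N ->
  L = (<[(vbasis L)`_0]> + <[(vbasis L)`_1]>)%VS.
Proof.
move=> L2; rewrite -[LHS](span_basis (vbasisP L)).
have : size (vbasis L) = 2%N by rewrite size_tuple.
case: (tval (vbasis L)) => [|u [|v []]] //= _.
by rewrite span_cons span_seq1.
Qed.

(** Otherwise the first basis vector would be orthogonal to all of [L], hence zero. *)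
Lemma symplectic_plane_basis L : \dim L = 2%N -> symplectic_subspace L ->
  omega (vbasis L)`_0 (vbasis L)`_1 != 0.
Proof.
move=> L2 Ls; apply/eqP => uv0.
have Luv := vspace2_vbasis L2.
have uL : (vbasis L)`_0 \in L.
  by apply: vbasis_mem; rewrite mem_nth // size_tuple L2.
have /(free_not0 (basis_free (vbasisP L))) : (vbasis L)`_0 \in vbasis L.
  by rewrite mem_nth // size_tuple L2.
rewrite (Ls _ uL) ?eqxx // => y; rewrite {1}Luv => /memv_addP[_ /vlineP[a ->]].
by case=> [_ /vlineP[b ->] ->]; rewrite omega_lin2r omega_xx uv0 !mulr0 addr0.
Qed.

(** The right-hand side lies in [L] and differs from [x] by a vector orthogonal to both basis
    vectors. *)
Lemma symplectic_projE L x (u := (vbasis L)`_0) (v := (vbasis L)`_1) :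
  \dim L = 2%N -> symplectic_subspace L ->
  symplectic_proj L x =
    (omega x v / omega u v) *: u + (omega u x / omega u v) *: v.
Proof.
move=> L2 Ls; have uv0 : omega u v != 0 := symplectic_plane_basis L2 Ls.
have Luv : L = (<[u]> + <[v]>)%VS := vspace2_vbasis L2.
set x' := (X in _ = X).
have x'L : x' \in L.
  by rewrite Luv; apply: memv_add; rewrite memvZ ?memv_line.
pose M := orthov (omega : {skew_symmetric V}) L.
have LM0 : (L :&: M = 0)%VS.
  apply/eqP; rewrite -subv0; apply/subvP => y; rewrite memv_cap memv0.
  by move=> /andP[yL /mem_orthovP yM]; apply/eqP; exact: Ls.
have xM : x - x' \in M.
  apply/mem_orthovP => y; rewrite {1}Luv => /memv_addP[_ /vlineP[a ->]].
  case=> [_ /vlineP[b ->] ->] /=.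
  rewrite -[x]scale1r -scaleN1r omega_lin2 !omega_lin2r /x' !omega_lin2 !omega_xx.
  by rewrite (omegaC x u) (omegaC v u); field.
have := daddv_pi_id LM0 x'L; rewrite /symplectic_proj -/M => x'E.
have ML0 : (M :&: L = 0)%VS by rewrite capvC.
(* The two projections of [x - x'] add up to it, and the one onto [M] already equals it, so the one
   onto [L] vanishes. *)
have := daddv_pi_add LM0 (subvP (addvSr L M) _ xM).
rewrite (daddv_pi_id ML0 xM) => /eqP; rewrite -subr_eq0 addrK => /eqP px0.
by rewrite -[x in LHS](subrK x') linearD /= px0 x'E add0r.
Qed.

End SymplecticPlane.

(** * Reduction of the capacity bound to the planar estimate *)

Theorem corollary6p4 (R : realType) (n : nat) (hn : (0 < n)%N)
    (X : set 'rV[R]_(n + n)) (hX : convex_body X)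
    (hsym : centrally_symmetric X) :
  ((3 * c_J X)%:E <= c_ZA X)%E.
Proof.
apply: le_ereal_inf_tmp => _ [L [L2 Ls] <-]; rewrite /symplectic_area.
set u := (vbasis L)`_0; set v := (vbasis L)`_1.
have w0 : omega u v != 0 := symplectic_plane_basis L2 Ls.
set w := omega u v in w0 *.
(* The coordinates of the projection of [x] in the basis [u], [v]. *)
pose g x : R * R := (omega x v / w, omega u x / w).
have gE a b x y : g (a *: x + b *: y) =
    (a * (g x).1 + b * (g y).1, a * (g x).2 + b * (g y).2).
  by rewrite /g /= omega_lin2 omega_lin2r; congr (_, _); ring.
have guv a b : g (a *: u + b *: v) = (a, b).
  by rewrite /g omega_lin2 omega_lin2r !omega_xx -/w; congr (_, _); field.
rewrite (_ : [set p | _] = g @` X); last first.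
  apply/seteqP; split=> -[a b] /=.
    move=> [x Xx]; rewrite symplectic_projE // -/u -/v -/w => E; exists x => //.
    have <- := guv a b; rewrite -E; exact/esym/guv.
  move=> [x Xx [<- <-]]; exists x => //; exact: symplectic_projE.
set K := g @` X; have [Xco Xc _] := hX.
have gC : continuous g.
  have -> : g = fun x => (omega x v * w^-1, omega x u * - w^-1).
    by apply/funext => x; rewrite /g (omegaC u); congr (_, _); ring.
  have c y a : continuous (fun x : 'rV[R]_(n + n) => omega x y * a).
    move=> x; apply: (@continuous_comp _ _ _ (omega^~ y) ( *%R^~ a)).
      exact: continuous_omegal.
    exact: mulrr_continuous.
  by move=> x; exact: (cvg_pair (c v w^-1 x) (c u (- w^-1) x)).
have Kco : compact K.
  by apply: continuous_compact => //; exact: continuous_subspaceT.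
have mK : measurable K.
  rewrite -[K]setCK; apply: measurableC; apply: measurable_open2.
  by rewrite openC; apply: compact_closed => //; exact: norm_hausdorff.
have K_conv x y x' y' t : 0 <= t <= 1 -> K (x, y) -> K (x', y') ->
    K (t * x + (1 - t) * x', t * y + (1 - t) * y').
  move=> t01 [z Xz gz] [z' Xz' gz']; exists (t *: z + (1 - t) *: z').
    exact: convex_setP.
  by rewrite gE gz gz'.
have K_sym x y : K (x, y) -> K (- x, - y).
  move=> [z Xz gz]; exists (- z); first exact: centrally_symmetricN.
  by rewrite -scaleN1r -[-1 *: z]addr0 -(scale0r z) gE gz /=; congr (_, _); ring.
(* The point is lifted to [x u + y v], on which [g] returns the coordinates, and shrunk into a cube
   inside [X]; [M] strictly exceeds every coordinate of the lift. *)
have K_abs x y : exists2 r, 0 < r & K (r * x, r * y).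
  have [r r0 rX] := symmetric_body_ball hX hsym.
  pose z := x *: u + y *: v; pose M := 1 + \sum_i `|z 0 i|.
  have zM i : `|z 0 i| < M.
    by rewrite /M (bigD1 i) //= addrCA ltrDl ltr_pwDl // sumr_ge0.
  have M0 : 0 < M by rewrite /M ltr_pwDl // sumr_ge0.
  exists (r / M); first exact: divr_gt0.
  exists ((r / M) *: z); last by rewrite /z scalerDr !scalerA guv.
  apply: rX => i; rewrite mxE normrM gtr0_norm ?divr_gt0 //.
  by rewrite mulrAC ltr_pdivrMr // ltr_pM2l.
have K_def x y : (forall r, 0 < r -> K (r * x, r * y)) -> x = 0 /\ y = 0.
  have [M [_ KM]] := compact_bounded Kco.
  have {}KM : forall p, K p -> `|p| <= M + 1 by apply: KM; rewrite ltrDl.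
  move=> Kr; have eq0 z : (forall r, 0 < r -> `|r * z| <= M + 1) -> z = 0.
    move=> rz; apply/eqP; apply: contraT => z0.
    have nz : 0 < `|z| by rewrite normr_gt0.
    have M1 : 0 < `|M + 1| + 1 by rewrite ltr_wpDl.
    have := rz ((`|M + 1| + 1) / `|z|) (divr_gt0 M1 nz).
    rewrite normrM gtr0_norm ?divr_gt0 // divfK ?gt_eqF //.
    by have := ler_norm (M + 1); lra.
  by split; apply: eq0 => r r0; apply: le_trans (KM _ (Kr r r0));
    rewrite prod_normE /= le_max lexx ?orbT.
have NN := gauge_planar_norm K_conv K_sym K_abs K_def.
rewrite /c_J; set S := sup _.
have Kdual f h : dual_ball (gauge K) f -> dual_ball (gauge K) h ->
    `|det2 f h| <= `|w| * S.
  (* The vector of [L] that represents the functional: [omega x (y f)] is [f] applied to [g x]. *)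
  pose y (f : R * R) : 'rV[R]_(n + n) := (- f.2 / w) *: u + (f.1 / w) *: v.
  have yP e : dual_ball (gauge K) e -> symplectic_polar X (y e).
    move=> eN x Xx; apply: le_trans (_ : e.1 * (g x).1 + e.2 * (g x).2 <= _).
      rewrite /y omega_lin2r /g /= (omegaC x u) le_eqVlt; apply/orP; left.
      by apply/eqP; field.
    by apply: (le_trans (eN _ _)); apply: gauge_le1 => //; exists x; case: (g x).
  move=> fN hN; have -> : det2 f h = w * omega (y f) (y h).
    rewrite /y omega_lin2 !omega_lin2r !omega_xx (omegaC v u) -/w /det2.
    by field.
  rewrite normrM ler_wpM2l //; apply: ub_le_sup.
    exact: polar_omega_bounded.
  by exists (y f), (y h); split=> //; exact: yP.
have N1 p : gauge K p.1 p.2 < 1 -> K p.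
  by case: p => a b; exact: gauge_lt1.
have areaK := area_planar_norm_ge NN mK N1 Kdual.
(* The factor [|w|] in the symplectic area cancels the one in the bound on the dual determinants. *)
have -> : 3 / S = `|w| * (3 / (`|w| * S)).
  by rewrite invfM mulrCA mulVKf ?normr_eq0.
by rewrite EFinM lee_pmul2l // lte_fin normr_gt0.
Qed.
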